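(* There are precisely four $\mathrm{Sym}$-invariant cones $C\subseteq\mathbb{R}^{(\mathbb{N})}$ that are not pointed (i.e. with $\{u\in C\mid -u\in C\}\neq\{0\}$), namely $\mathfrak{C}_1=\mathbb{R}^{(\mathbb{N})}$, $\mathfrak{C}_2=\{u\mid s(u)=0\}=\mathbb{R}\,\mathrm{Sym}(e_1-e_2)$, $\mathfrak{C}_3=\{u\mid s(u)\ge0\}=\mathbb{R}_{\ge0}^{(\mathbb{N})}+\mathbb{R}\,\mathrm{Sym}(e_1-e_2)$, $\mathfrak{C}_4=\{u\mid s(u)\le0\}=\mathbb{R}_{\le0}^{(\mathbb{N})}+\mathbb{R}\,\mathrm{Sym}(e_1-e_2)$. In particular, every non-pointed $\mathrm{Sym}$-invariant cone in $\mathbb{R}^{(\mathbb{N})}$ is $\mathrm{Sym}$-equivariantly finitely generated.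
   Context: $\mathbb{R}^{(\mathbb{N})}$ denotes the space of real sequences $u=(u_i)_{i\in\mathbb{N}}$ with only finitely many nonzero entries, with standard basis $e_1,e_2,\dots$; $s(u)=\sum_iu_i$. $\mathrm{Sym}$ is the group of permutations of $\mathbb{N}$ fixing all but finitely many elements, acting by $\sigma(u)=\sum_iu_ie_{\sigma(i)}$; $\mathrm{Sym}(v)$ denotes the orbit of $v$ and $\mathbb{R}\,\mathrm{Sym}(v)$ its linear span. $\mathbb{R}^{(\mathbb{N})}_{\ge0}$ (resp. $\le0$) is the set of elements with all entries $\ge0$ (resp. $\le0$). A cone is a nonempty subset closed under addition and nonnegative scaling; it is $\mathrm{Sym}$-equivariantly finitely generated if it equals the set of nonnegative combinations of $\{\sigma(a)\mid \sigma\in\mathrm{Sym},a\in A\}$ for a finite $A$. *)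

(* Defs.v *)
From mathcomp Require Export all_boot all_order all_algebra.
From mathcomp Require Export finmap.
From mathcomp Require Export boolp classical_sets functions cardinality reals.
From mathcomp.multinomials Require Export monalg.

Set Implicit Arguments.
Unset Strict Implicit.
Unset Printing Implicit Defensive.

Export Order.TTheory GRing.Theory Num.Theory.

Local Open Scope classical_set_scope.
Local Open Scope card_scope.
Local Open Scope ring_scope.

(* The index set is nat, so the basis vectors e_1, e_2, ... of the usual
   1-based numbering are [basis_vec 0], [basis_vec 1], ... *)
Definition fsseq (R : realType) := {malg R[nat]}.

Definition basis_vec (R : realType) (i : nat) : fsseq R := << i >>.

Definition coord_sum (R : realType) (u : fsseq R) : R :=
  \sum_(i <- msupp u) u@_i.

Definition Sym : set (nat -> nat) :=
  [set p | bijective p /\ finite_set [set i | p i <> i]].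

Definition sym_act (R : realType) (p : nat -> nat) (u : fsseq R) : fsseq R :=
  \sum_(i <- msupp u) u@_i *: basis_vec R (p i).

Definition Sym_orbits (R : realType) (A : set (fsseq R)) : set (fsseq R) :=
  [set sym_act p a | p in Sym & a in A].

Definition Sym_invariant (R : realType) (C : set (fsseq R)) : Prop :=
  forall p u, Sym p -> C u -> C (sym_act p u).

Definition linear_span (R : realType) (V : lmodType R) (A : set V) : set V :=
  [set v | exists (n : nat) (c : 'I_n -> R) (a : 'I_n -> V),
     (forall i, A (a i)) /\ v = \sum_(i < n) c i *: a i].

Definition conic_span (R : realType) (V : lmodType R) (A : set V) : set V :=
  [set v | exists (n : nat) (c : 'I_n -> R) (a : 'I_n -> V),
     (forall i, 0 <= c i /\ A (a i)) /\ v = \sum_(i < n) c i *: a i].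

Definition minkowski_sum (V : zmodType) (A B : set V) : set V :=
  [set a + b | a in A & b in B].

Definition is_cone (R : realType) (V : lmodType R) (C : set V) : Prop :=
  [/\ C !=set0,
      forall u v, C u -> C v -> C (u + v) &
      forall (r : R) u, 0 <= r -> C u -> C (r *: u)].

Definition is_pointed (V : zmodType) (C : set V) : Prop :=
  [set u | C u /\ C (- u)] = [set 0].

Definition Sym_finitely_generated (R : realType) (C : set (fsseq R)) : Prop :=
  exists2 A : set (fsseq R), finite_set A & C = conic_span (Sym_orbits A).

Definition nonneg_seqs (R : realType) : set (fsseq R) :=
  [set u | forall i : nat, 0 <= u@_i].

Definition nonpos_seqs (R : realType) : set (fsseq R) :=
  [set u | forall i : nat, u@_i <= 0].

Definition span_Sym_diff (R : realType) : set (fsseq R) :=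
  linear_span (Sym_orbits [set basis_vec R 0 - basis_vec R 1]).

Definition cone1 (R : realType) : set (fsseq R) := setT.
Definition cone2 (R : realType) : set (fsseq R) := [set u | coord_sum u = 0].
Definition cone3 (R : realType) : set (fsseq R) := [set u | 0 <= coord_sum u].
Definition cone4 (R : realType) : set (fsseq R) := [set u | coord_sum u <= 0].

Definition nonpointed_Sym_cones (R : realType) : set (set (fsseq R)) :=
  [set C | [/\ is_cone C, Sym_invariant C & ~ is_pointed C]].

Arguments nonneg_seqs R : clear implicits.
Arguments nonpos_seqs R : clear implicits.
Arguments span_Sym_diff R : clear implicits.
Arguments cone1 R : clear implicits.
Arguments cone2 R : clear implicits.
Arguments cone3 R : clear implicits.
Arguments cone4 R : clear implicits.
Arguments nonpointed_Sym_cones R : clear implicits.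

(* Main.v *)
From HB Require Import structures.
Require Import Defs.

Set Implicit Arguments.
Unset Strict Implicit.
Unset Printing Implicit Defensive.

(** A nonzero [u] with [u] and [- u] in [C] has some coordinate [u_i <> 0], and some
    [j] lies outside its support.  Applying the transposition [(i j)] to [u] and
    subtracting leaves [u_i (e_i - e_j)], so [C] contains [e_i - e_j] up to a sign and
    hence, by invariance, every [e_k - e_l].  Modulo these vectors [u] is congruent to
    [s(u) e_0], so [C] is determined by which of [e_0] and [- e_0] it contains. *)

Local Open Scope ring_scope.
Local Open Scope classical_set_scope.
Local Open Scope card_scope.

(** * Linearity of the permutation action and of the coordinate sum *)

(** The linear map sending each [e_i] to [f i]. Both [sym_act p] and [coord_sum] are of this form,
    so linearity is proved once. *)
Definition linear_ext (R : realType) (V : lmodType R) (f : nat -> V)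
  (u : fsseq R) : V := \sum_(i <- msupp u) u@_i *: f i.

(** Coefficients vanish off the support, so vectors with different supports can be summed over one
    common index set. *)
Lemma linear_extEw (R : realType) (V : lmodType R) (f : nat -> V)
    (d : {fset nat}) (u : fsseq R) :
  (msupp u `<=` d)%fset -> linear_ext f u = \sum_(i <- d) u@_i *: f i.
Proof.
move=> ud; apply: big_fset_incl => // i _ iNu.
by rewrite mcoeff_outdom // scale0r.
Qed.

Lemma linear_ext_is_linear (R : realType) (V : lmodType R) (f : nat -> V) :
  linear (linear_ext f).
Proof.
move=> a u v.
pose d := (msupp u `|` msupp v `|` msupp (a *: u + v))%fset.
have du : (msupp u `<=` d)%fset by rewrite /d -fsetUA fsubsetUl.
have dv : (msupp v `<=` d)%fset by rewrite /d fsetUAC fsubsetUr.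
have duv : (msupp (a *: u + v) `<=` d)%fset by rewrite /d fsubsetUr.
rewrite (linear_extEw f du) (linear_extEw f dv) (linear_extEw f duv).
rewrite scaler_sumr -big_split /=; apply: eq_bigr => i _.
by rewrite mcoeffD mcoeffZ scalerDl scalerA.
Qed.

Lemma linear_ext_basis (R : realType) (V : lmodType R) (f : nat -> V) i :
  linear_ext f (basis_vec R i) = f i.
Proof.
by rewrite (linear_extEw _ msuppU_le) big_seq_fset1 mcoeffUU scale1r.
Qed.

HB.instance Definition _ (R : realType) (p : nat -> nat) :=
  GRing.isLinear.Build R (fsseq R) (fsseq R) *:%R (@sym_act R p)
    (linear_ext_is_linear (fun i => basis_vec R (p i))).

Lemma coord_sumE (R : realType) (u : fsseq R) :
  coord_sum u = linear_ext (fun=> 1 : R^o) u.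
Proof. by apply: eq_bigr => i _; rewrite /GRing.scale /= mulr1. Qed.

Lemma coord_sum_is_linear (R : realType) : scalar (@coord_sum R).
Proof. by move=> a u v; rewrite !coord_sumE linear_ext_is_linear. Qed.

HB.instance Definition _ (R : realType) :=
  GRing.isLinear.Build R (fsseq R) R *%R (@coord_sum R)
    (@coord_sum_is_linear R).

Lemma sym_act_basis (R : realType) p i :
  sym_act p (basis_vec R i) = basis_vec R (p i).
Proof. exact: linear_ext_basis. Qed.

Lemma coord_sum_basis (R : realType) i : coord_sum (basis_vec R i) = 1.
Proof. by rewrite coord_sumE linear_ext_basis. Qed.

Lemma fsseqE (R : realType) (u : fsseq R) :
  u = \sum_(i <- msupp u) u@_i *: basis_vec R i.
Proof.
rewrite {1}(monalgE u); apply: eq_bigr => i _; apply/malgP => k.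
by rewrite mcoeffZ !mcoeffU mulr_natr.
Qed.

Lemma coord_sum_sym_act (R : realType) p (u : fsseq R) :
  coord_sum (sym_act p u) = coord_sum u.
Proof.
rewrite /sym_act linear_sum; apply: eq_bigr => i _.
by rewrite linearZ /= coord_sum_basis mulr1.
Qed.

Lemma sym_act_comp (R : realType) p q (u : fsseq R) :
  sym_act p (sym_act q u) = sym_act (p \o q) u.
Proof.
rewrite {2}/sym_act linear_sum; apply: eq_bigr => i _.
by rewrite linearZ /= sym_act_basis.
Qed.

Lemma sym_act_id (R : realType) (u : fsseq R) : sym_act id u = u.
Proof. by rewrite [RHS]fsseqE. Qed.

(** * Finitary permutations and transpositions *)

Lemma Sym_id : Sym id.
Proof.
split; first by exists id.
by apply: (@sub_finite_set _ _ set0) => // i /=.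
Qed.

Lemma Sym_comp p q : Sym p -> Sym q -> Sym (p \o q).
Proof.
move=> [bp fp] [bq fq]; split; first exact: bij_comp.
apply: (@sub_finite_set _ _ ([set i | p i <> i] `|` [set i | q i <> i])).
  move=> i /= pqi; have [qi|/eqP qi] := eqVneq (q i) i; last by right.
  by left=> pi; apply: pqi; rewrite qi.
by rewrite finite_setU.
Qed.

Definition transposition (i j k : nat) : nat :=
  if k == i then j else if k == j then i else k.

Lemma transpositionL i j : transposition i j i = j.
Proof. by rewrite /transposition eqxx. Qed.

Lemma transpositionR i j : transposition i j j = i.
Proof. by rewrite /transposition eqxx; case: eqP => [->|]. Qed.

Lemma transpositionD i j k : k != i -> k != j -> transposition i j k = k.
Proof. by rewrite /transposition => /negPf-> /negPf->. Qed.

Lemma transpositionK i j : involutive (transposition i j).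
Proof.
move=> k; have [->|ki] := eqVneq k i.
  by rewrite transpositionL transpositionR.
have [->|kj] := eqVneq k j; first by rewrite transpositionR transpositionL.
by rewrite !transpositionD.
Qed.

Lemma Sym_transposition i j : Sym (transposition i j).
Proof.
split; first exact: inv_bij (transpositionK i j).
apply: (@sub_finite_set _ _ [set i; j]) => // k /= pk.
have [->|ki] := eqVneq k i; first by left.
have [->|kj] := eqVneq k j; first by right.
by case: pk; rewrite transpositionD.
Qed.

Lemma basis_vec_inj (R : realType) : injective (basis_vec R).
Proof.
move=> i j /(congr1 (mcoeff i)); rewrite !mcoeffU eqxx.
by case: eqP => // _ /eqP; rewrite oner_eq0.
Qed.

Lemma exists_notin_msupp (R : realType) (u : fsseq R) :
  exists j, j \notin msupp u.
Proof.
(* One more than the largest index of the support. *)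
exists (\max_(k <- msupp u) k).+1; apply/negP => /leq_bigmax_seq.
by move=> /(_ xpredT id isT); rewrite ltnn.
Qed.

(** Since [j] is outside the support, every support index other than [i] is fixed and its term
    cancels. *)
Lemma sub_sym_act_transposition (R : realType) (u : fsseq R) i j :
  i \in msupp u -> j \notin msupp u ->
  u - sym_act (transposition i j) u =
    u@_i *: (basis_vec R i - basis_vec R j).
Proof.
move=> iu jNu; rewrite {1}[u]fsseqE /sym_act -sumrB.
rewrite (bigD1_seq i) ?fset_uniq //= big_seq_cond big1 ?addr0.
  by rewrite transpositionL -scalerBr.
move=> k /andP[ku ki]; rewrite transpositionD ?subrr //.
by apply: contraNneq jNu => <-.
Qed.

(** * Cones, conic spans and linear spans *)

Lemma cone0 (R : realType) (V : lmodType R) (C : set V) : is_cone C -> C 0.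
Proof. by case=> -[u Cu] _ CZ; rewrite -(scale0r u); exact: CZ. Qed.

Lemma cone_sum (R : realType) (V : lmodType R) (C : set V) (I : Type)
    (r : seq I) (P : pred I) (F : I -> V) :
  is_cone C -> (forall i, P i -> C (F i)) -> C (\sum_(i <- r | P i) F i).
Proof.
by move=> coneC CF; elim/big_ind: _ => //; [exact: cone0|case: coneC].
Qed.

Lemma conic_span_cone (R : realType) (V : lmodType R) (A : set V) :
  is_cone (conic_span A).
Proof.
split.
- by exists 0, 0%N, (fun=> 0), (fun=> 0); split=> [[]//|]; rewrite big_ord0.
- move=> _ _ [m [c [a [ca ->]]]] [n [d [b [db ->]]]].
  (* Concatenates two finite families, used for coefficients and for vectors alike. *)
  pose glue T (f : 'I_m -> T) (g : 'I_n -> T) k :=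
    match fintype.split k with inl i => f i | inr j => g j end.
  exists (m + n)%N, (glue _ c d), (glue _ a b); split.
    by move=> k; rewrite /glue; case: fintype.split => i; [exact: ca|exact: db].
  rewrite big_split_ord /=; congr (_ + _); apply: eq_bigr => i _.
    by rewrite /glue (unsplitK (inl _ i)).
  by rewrite /glue (unsplitK (inr _ i)).
- move=> r _ r0 [n [c [a [ca ->]]]].
  exists n, (fun i => r * c i), a; split.
    by move=> i; have [c0 Aa] := ca i; rewrite mulr_ge0.
  by rewrite scaler_sumr; apply: eq_bigr => i _; rewrite scalerA.
Qed.

Lemma sub_conic_span (R : realType) (V : lmodType R) (A : set V) :
  A `<=` conic_span A.
Proof.
move=> a Aa; exists 1%N, (fun=> 1), (fun=> a).
by rewrite big_ord1 scale1r.
Qed.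

Lemma conic_span_sub (R : realType) (V : lmodType R) (A C : set V) :
  is_cone C -> A `<=` C -> conic_span A `<=` C.
Proof.
move=> coneC AC _ [n [c [a [ca ->]]]]; apply: cone_sum => // i _.
by have [c0 /AC Ca] := ca i; case: coneC => _ _; apply.
Qed.

Lemma linear_span_seq (R : realType) (V : lmodType R) (A : set V)
    (I : Type) (r : seq I) (P : pred I) (c : I -> R) (a : I -> V) :
  (forall i, P i -> A (a i)) ->
  linear_span A (\sum_(i <- r | P i) c i *: a i).
Proof.
move=> Aa; rewrite -big_filter.
exists (size (filter P r)), (fun i => c (tnth (in_tuple (filter P r)) i)),
  (fun i => a (tnth (in_tuple (filter P r)) i)); split; last exact: big_tnth.
move=> i; apply: Aa.
exact: (all_tnthP (t := in_tuple (filter P r)) (filter_all P r)).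
Qed.

Lemma Sym_orbits_sub (R : realType) (A : set (fsseq R)) : A `<=` Sym_orbits A.
Proof. by move=> a Aa; exists id; [exact: Sym_id|exists a; rewrite ?sym_act_id]. Qed.

Lemma conic_span_Sym_orbits_invariant (R : realType) (A : set (fsseq R)) :
  Sym_invariant (conic_span (Sym_orbits A)).
Proof.
move=> p _ symp [n [c [a [ca ->]]]].
exists n, c, (fun i => sym_act p (a i)); split.
  move=> i; have [c0 [q symq [b Ab <-]]] := ca i; split=> //.
  by rewrite sym_act_comp; exists (p \o q); [exact: Sym_comp|exists b].
by rewrite linear_sum; apply: eq_bigr => i _; rewrite linearZ.
Qed.

(** * Differences of basis vectors in a non-pointed cone *)

(** Two transpositions suffice: [(i k)] moves [i] to [k] and [j] to some [j'], then [(j' l)] moves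
    [j'] to [l] and fixes [k], which differs from both. *)
Lemma basis_diff_transitive (R : realType) (C : set (fsseq R)) (i j k l : nat) :
  Sym_invariant C -> i != j -> k != l ->
  C (basis_vec R i - basis_vec R j) -> C (basis_vec R k - basis_vec R l).
Proof.
move=> invC ij kl Cij; pose j' := transposition i k j.
have kj' : k != j'.
  apply/eqP => kj'; case/eqP: ij; apply: (inv_inj (transpositionK i k)).
  by rewrite transpositionL.
have := invC _ _ (Sym_transposition i k) Cij.
rewrite linearB /= !sym_act_basis transpositionL -/j'.
move=> /(invC _ _ (Sym_transposition j' l)).
by rewrite linearB /= !sym_act_basis transpositionL transpositionD.
Qed.

Lemma nonpointed_basis_diff (R : realType) (C : set (fsseq R)) :
  nonpointed_Sym_cones R C -> C (basis_vec R 0 - basis_vec R 1).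
Proof.
move=> [coneC invC npC]; have [_ CD CZ] := coneC.
suff [i [j [ij Cij]]] :
    exists i j, i != j /\ C (basis_vec R i - basis_vec R j).
  exact: basis_diff_transitive Cij.
have [u [Cu CNu u0]] : exists u, [/\ C u, C (- u) & u != 0].
  apply: contrapT => noline; apply: npC; rewrite /is_pointed.
  apply/seteqP; split=> [u [Cu CNu]|u /= ->]; last first.
    by rewrite oppr0; split; exact: cone0.
  by apply: contrapT => /eqP u0; apply: noline; exists u.
have [supp0|[i iu]] := fset_0Vmem (msupp u).
  by case/eqP: u0; rewrite [u]fsseqE supp0 big_seq_fset0.
have [j jNu] := exists_notin_msupp u.
have ij : i != j by apply: contraNneq jNu => <-.
have Cuij : C (u@_i *: (basis_vec R i - basis_vec R j)).
  rewrite -sub_sym_act_transposition // -linearN; apply: CD => //.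
  exact: invC (Sym_transposition i j) CNu.
have ui0 : u@_i != 0 by rewrite mcoeff_neq0.
(* Only nonnegative scaling is allowed, so a negative [u_i] is absorbed by exchanging [i] and
   [j]. *)
have [uile0|uigt0] := leP (u@_i) 0.
  exists j, i; split; first by rewrite eq_sym.
  rewrite -opprB -scaleN1r -(mulVf ui0) -mulNr -scalerA.
  by apply: CZ => //; rewrite oppr_ge0 invr_le0.
exists i, j; split=> //; rewrite -[X in C X]scale1r -(mulVf ui0) -scalerA.
by apply: CZ => //; rewrite invr_ge0 ltW.
Qed.

(** * Membership through the coordinate sum *)

Lemma fsseq_sub_coord_sum (R : realType) (u : fsseq R) :
  u - coord_sum u *: basis_vec R 0 =
    \sum_(i <- msupp u) u@_i *: (basis_vec R i - basis_vec R 0).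
Proof.
rewrite {1}[u]fsseqE /coord_sum scaler_suml -sumrB.
by apply: eq_bigr => i _; rewrite scalerBr.
Qed.

(** [C] contains the differences [e_k - e_l] in both orders, so it absorbs coefficients of either
    sign on them, and these differences span the vectors of sum zero. *)
Lemma coord_sum0_mem (R : realType) (C : set (fsseq R)) u :
  is_cone C -> Sym_invariant C -> C (basis_vec R 0 - basis_vec R 1) ->
  coord_sum u = 0 -> C u.
Proof.
move=> coneC invC C01 su0.
have Ckl k l : C (basis_vec R k - basis_vec R l).
  have [->|kl] := eqVneq k l; first by rewrite subrr; exact: cone0.
  exact: basis_diff_transitive C01.
have -> : u = u - coord_sum u *: basis_vec R 0 by rewrite su0 scale0r subr0.
rewrite fsseq_sub_coord_sum; apply: cone_sum => // i _; case: coneC => _ _ CZ.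
have [ui0|uilt0] := leP 0 (u@_i); first exact: CZ.
by rewrite -opprB scalerN -scaleNr; apply: CZ => //; rewrite oppr_ge0 ltW.
Qed.

(** The vector [u - s(u) e_0] and its opposite both have sum zero, hence lie in [C]; adding one or
    the other gives the two directions. *)
Lemma mem_coord_sum (R : realType) (C : set (fsseq R)) u :
  is_cone C -> Sym_invariant C -> C (basis_vec R 0 - basis_vec R 1) ->
  C u <-> C (coord_sum u *: basis_vec R 0).
Proof.
move=> coneC invC C01; have [_ CD _] := coneC.
have s0 : coord_sum (u - coord_sum u *: basis_vec R 0) = 0.
  by rewrite linearB linearZ /= coord_sum_basis mulr1 subrr.
split=> Cu; last first.
  rewrite -(subrK (coord_sum u *: basis_vec R 0) u); apply: CD => //.
  exact: coord_sum0_mem.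
rewrite -[X in C X](addrNK u); apply: CD => //; apply: coord_sum0_mem => //.
by rewrite -opprB linearN /= s0 oppr0.
Qed.

Lemma cone_scale_basis (R : realType) (V : lmodType R) (C : set V) (a : R) v :
  is_cone C ->
  C (a *: v) <-> [\/ a = 0, 0 < a /\ C v | a < 0 /\ C (- v)].
Proof.
move=> coneC; have [_ _ CZ] := coneC; split.
  move=> Cav; have [a0|a0|->] := ltgtP a 0; last exact: Or31.
    apply: Or33; split=> //; rewrite -scaleN1r -(mulVf (ltr0_neq0 a0)) -mulNr.
    by rewrite -scalerA; apply: CZ => //; rewrite oppr_ge0 invr_le0 ltW.
  apply: Or32; split=> //; rewrite -[v]scale1r -(mulVf (lt0r_neq0 a0)).
  by rewrite -scalerA; apply: CZ => //; rewrite invr_ge0 ltW.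
move=> [->|[a0 Cv]|[a0 Cv]]; first by rewrite scale0r; exact: cone0.
  by apply: CZ => //; rewrite ltW.
by rewrite -[a]opprK scaleNr -scalerN; apply: CZ => //; rewrite oppr_ge0 ltW.
Qed.

(** Only the sign of the sum matters, so two such cones agree once they agree on [e_0] and [- e_0].
    Both the classification and finite generation rest on this criterion. *)
Lemma mem_nonpointed (R : realType) (C : set (fsseq R)) u :
  is_cone C -> Sym_invariant C -> C (basis_vec R 0 - basis_vec R 1) ->
  C u <-> [\/ coord_sum u = 0, 0 < coord_sum u /\ C (basis_vec R 0)
            | coord_sum u < 0 /\ C (- basis_vec R 0)].
Proof.
move=> coneC invC C01.
exact: iff_trans (mem_coord_sum u coneC invC C01) (cone_scale_basis _ _ coneC).
Qed.

(** * Classification of the non-pointed invariant cones *)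

Lemma nonpointed_of_sub_cone2 (R : realType) (C : set (fsseq R)) :
  is_cone C -> Sym_invariant C -> cone2 R `<=` C -> nonpointed_Sym_cones R C.
Proof.
move=> coneC invC sub2; split=> // ptC.
have s01 : coord_sum (basis_vec R 0 - basis_vec R 1) = 0.
  by rewrite linearB /= !coord_sum_basis subrr.
have : [set u | C u /\ C (- u)] (basis_vec R 0 - basis_vec R 1).
  by split; apply: sub2; rewrite /cone2 /= ?linearN /= s01 ?oppr0.
by rewrite ptC => /subr0_eq /basis_vec_inj.
Qed.

(** The four cones are the preimages under [s] of the line, the origin and the two half-lines, so
    they can be treated together. *)
Lemma coord_sum_preimage_nonpointed (R : realType) (J : set R) :
  is_cone (J : set R^o) -> nonpointed_Sym_cones R [set u | J (coord_sum u)].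
Proof.
move=> coneJ; have [_ JD JZ] := coneJ.
apply: nonpointed_of_sub_cone2 => [|p u _ /=|u /= ->]; last exact: cone0 coneJ.
  split.
  - by exists 0; rewrite /= linear0; exact: cone0 coneJ.
  - by move=> u v Ju Jv /=; rewrite linearD; exact: JD.
  - by move=> r u r0 Ju /=; rewrite linearZ; exact: JZ.
by rewrite coord_sum_sym_act.
Qed.

Lemma nonpointed_Sym_conesE (R : realType) :
  nonpointed_Sym_cones R = [set cone1 R; cone2 R; cone3 R; cone4 R].
Proof.
apply/seteqP; split=> [C npC|C].
  have C01 := nonpointed_basis_diff npC; have [coneC invC _] := npC.
  have memC u := mem_nonpointed u coneC invC C01.
  (* The four cases yield, in order, [cone1], [cone3], [cone4] and [cone2]. *)
  have [C0|C0] := pselect (C (basis_vec R 0));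
    have [CN0|CN0] := pselect (C (- basis_vec R 0)).
  - do 3 left; apply/seteqP; split=> // u _; apply/memC.
    by case: (ltgtP (coord_sum u) 0) => ?;
      [apply: Or33|apply: Or32|apply: Or31].
  - left; right; apply/seteqP; split=> u; rewrite /cone3 /=.
      by move=> /memC[->|[/ltW]|[]].
    by rewrite le_eqVlt => /predU1P[su|su]; apply/memC;
      [apply: Or31|apply: Or32].
  - right; apply/seteqP; split=> u; rewrite /cone4 /=.
      by move=> /memC[->|[]|[/ltW]].
    by rewrite le_eqVlt => /predU1P[su|su]; apply/memC;
      [apply: Or31|apply: Or33].
  - do 2 left; right; apply/seteqP; split=> u; rewrite /cone2 /=.
      by move=> /memC[|[]|[]].
    by move=> su; apply/memC; apply: Or31.
move=> [[[->|->]|->]|->].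
- by apply: (@coord_sum_preimage_nonpointed R setT); split=> //; exists 0.
- apply: (@coord_sum_preimage_nonpointed R [set 0]); split=> [|u v /= -> ->|].
  + by exists 0.
  + exact: addr0.
  + by move=> r u _ /= ->; rewrite scaler0.
- apply: (@coord_sum_preimage_nonpointed R [set x | 0 <= x]); split.
  + by exists 0 => /=.
  + by move=> u v; exact: addr_ge0.
  + by move=> r u; exact: mulr_ge0.
- apply: (@coord_sum_preimage_nonpointed R [set x | x <= 0]); split.
  + by exists 0 => /=.
  + by move=> u v /= u0 v0; rewrite -(addr0 0) lerD.
  + by move=> r u; exact: mulr_ge0_le0.
Qed.

(** * Descriptions by spans and Minkowski sums *)

Lemma cone2E (R : realType) : cone2 R = span_Sym_diff R.
Proof.
apply/seteqP; split=> u; last first.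
  move=> [n [c [a [Aa ->]]]]; rewrite /cone2 /= linear_sum big1 // => i _.
  have [p _ [_ -> <-]] := Aa i.
  rewrite linearZ /= coord_sum_sym_act linearB /=.
  by rewrite !coord_sum_basis subrr mulr0.
rewrite /cone2 /= => su0.
(* The zero term at [i = 0] is dropped because [e_0 - e_0] is not in the orbit; for [i != 0], the
   transposition [(1 i)] fixes [0] and carries [e_0 - e_1] to [e_0 - e_i]. *)
have -> : u = \sum_(i <- msupp u | i != 0%N)
                (- u@_i) *: (basis_vec R 0 - basis_vec R i).
  rewrite -[LHS]subr0 -[X in _ - X](scale0r (basis_vec R 0)) -su0.
  rewrite fsseq_sub_coord_sum [RHS]big_mkcond; apply: eq_bigr => i _.
  by case: eqP => [->|_]; rewrite ?subrr ?scaler0 // -opprB scalerN scaleNr.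
apply: linear_span_seq => i i0; exists (transposition 1 i).
  exact: Sym_transposition.
exists (basis_vec R 0 - basis_vec R 1) => //.
by rewrite linearB /= !sym_act_basis transpositionL transpositionD // eq_sym.
Qed.

(** Splits [u] as [s(u) e_0] plus a vector of sum zero; covers both half-spaces. *)
Lemma minkowski_cone2 (R : realType) (A : set (fsseq R)) (J : set R) :
  (forall u, A u -> J (coord_sum u)) ->
  (forall r, J r -> A (r *: basis_vec R 0)) ->
  [set u | J (coord_sum u)] = minkowski_sum A (cone2 R).
Proof.
move=> AJ JA; apply/seteqP; split=> u /=.
  move=> Ju; exists (coord_sum u *: basis_vec R 0); first exact: JA.
  exists (u - coord_sum u *: basis_vec R 0); last by rewrite addrC subrK.
  by rewrite /cone2 /= linearB linearZ /= coord_sum_basis mulr1 subrr.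
by move=> [v Av [w sw0 <-]]; rewrite linearD /= sw0 addr0; exact: AJ.
Qed.

Lemma cone3E (R : realType) :
  cone3 R = minkowski_sum (nonneg_seqs R) (span_Sym_diff R).
Proof.
rewrite -cone2E; apply: (minkowski_cone2 (J := [set x | 0 <= x])).
  by move=> u u0; apply: sumr_ge0 => i _; exact: u0.
by move=> r r0 i; rewrite mcoeffZ mcoeffU mulr_ge0 // ler0n.
Qed.

Lemma cone4E (R : realType) :
  cone4 R = minkowski_sum (nonpos_seqs R) (span_Sym_diff R).
Proof.
rewrite -cone2E; apply: (minkowski_cone2 (J := [set x | x <= 0])).
  by move=> u u0; apply: sumr_le0 => i _; exact: u0.
by move=> r r0 i; rewrite mcoeffZ mcoeffU mulr_le0_ge0 // ler0n.
Qed.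

(** * Finite generation and the count *)

(** The generators are those of [e_0 - e_1], [e_0], [- e_0] that lie in [C]. The cone they generate
    contains [e_0 - e_1], so the membership criterion applies to it as well as to [C]. *)
Lemma nonpointed_Sym_finitely_generated (R : realType) (C : set (fsseq R)) :
  nonpointed_Sym_cones R C -> Sym_finitely_generated C.
Proof.
move=> npC; have C01 := nonpointed_basis_diff npC; have [coneC invC _] := npC.
pose A := [set basis_vec R 0 - basis_vec R 1; basis_vec R 0; - basis_vec R 0]
  `&` C.
have AD : A `<=` conic_span (Sym_orbits A).
  by apply: (subset_trans (@Sym_orbits_sub R A)); exact: sub_conic_span.
exists A; first exact: finite_setIl.
apply/seteqP; split; last first.
  apply: conic_span_sub => // _ [p symp [a [_ Ca] <-]]; exact: invC.
have D01 : conic_span (Sym_orbits A) (basis_vec R 0 - basis_vec R 1).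
  by apply: AD; split=> //; left; left.
move=> u /(mem_nonpointed _ coneC invC C01) Cu.
apply/mem_nonpointed => //; first exact: conic_span_cone.
  exact: conic_span_Sym_orbits_invariant.
case: Cu => [|[su C0]|[su C0]]; [exact: Or31|apply: Or32|apply: Or33];
  split=> //; apply: AD; split=> //; [by left; right|by right].
Qed.

Lemma card_four_cones (R : realType) :
  [set cone1 R; cone2 R; cone3 R; cone4 R] #= `I_4.
Proof.
(* With the cones listed by [f], the count becomes injectivity of [f] on [I_4], where the default
   [setT] is never reached. *)
pose f := nth setT [:: cone1 R; cone2 R; cone3 R; cone4 R].
have -> : [set cone1 R; cone2 R; cone3 R; cone4 R] = f @` `I_4.
  apply/seteqP; split=> [C [[[->|->]|->]|->]|_ [[|[|[|[|//]]]] _ <-]].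
  - by exists 0%N.
  - by exists 1%N.
  - by exists 2%N.
  - by exists 3%N.
  - by do 3 left.
  - by do 2 left; right.
  - by left; right.
  - by right.
(* The four cones are told apart by which of [e_0] and [- e_0] they contain. *)
pose sign_pattern (C : set (fsseq R)) :=
  (`[< C (basis_vec R 0) >], `[< C (- basis_vec R 0) >]).
have sE : map sign_pattern [:: cone1 R; cone2 R; cone3 R; cone4 R]
    = [:: (true, true); (false, false); (true, false); (false, true)].
  rewrite /sign_pattern /cone1 /cone2 /cone3 /cone4 /=.
  rewrite linearN /= coord_sum_basis oppr_ge0 oppr_le0 ler01 ler10.
  have n10 : (1 : R) <> 0 by apply/eqP; rewrite oner_eq0.
  have nN10 : - (1 : R) <> 0 by apply/eqP; rewrite oppr_eq0 oner_eq0.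
  by do !congr (_ :: _); congr pair; apply/asboolP.
apply: inj_card_eq => i j; rewrite !inE /= => i4 j4 /(congr1 sign_pattern).
rewrite /f -!(nth_map setT (true, true)) // sE => /eqP.
by rewrite nth_uniq // => /eqP.
Qed.

Theorem theorem5p1 (R : realType) :
  [/\ nonpointed_Sym_cones R #= `I_4,
      nonpointed_Sym_cones R = [set cone1 R; cone2 R; cone3 R; cone4 R],
      [/\ cone2 R = span_Sym_diff R,
          cone3 R = minkowski_sum (nonneg_seqs R) (span_Sym_diff R) &
          cone4 R = minkowski_sum (nonpos_seqs R) (span_Sym_diff R)] &
      forall C : set (fsseq R),
        is_cone C -> Sym_invariant C -> ~ is_pointed C ->
        Sym_finitely_generated C].
Proof.
split.
- by rewrite nonpointed_Sym_conesE; exact: card_four_cones.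
- exact: nonpointed_Sym_conesE.
- by split; [exact: cone2E|exact: cone3E|exact: cone4E].
- by move=> C coneC invC npC; exact: nonpointed_Sym_finitely_generated.
Qed.
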